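(* Let $n\ge2$, let $G\subsetneq\mathbb{R}^n$ be a domain and let $f:G\to fG\subsetneq\mathbb{R}^n$ be a sense-preserving homeomorphism satisfying the $L$-bilipschitz condition ($L\ge1$) with respect to the distance ratio metric or the quasihyperbolic metric; that is, with $m=j$ or with $m=k$, $$m_G(x,y)/L\le m_{fG}(f(x),f(y))\le L\,m_G(x,y)\quad\text{for all }x,y\in G.$$ Then $f$ is quasiconformal with linear dilatation $H(f)\leq L^2$.
   Context: For a domain $G\subsetneq\mathbb{R}^n$ and $x,y\in G$, with $d(x,\partial G)$ the Euclidean distance to the boundary: the distance ratio metric is $j_G(x,y)=\log\left(1+\frac{|x-y|}{\min\{d(x,\partial G),d(y,\partial G)\}}\right)$; the quasihyperbolic metric is $k_G(x,y)=\inf_\gamma\int_\gamma\frac{|dz|}{d(z,\partial G)}$, the infimum being over all rectifiable arcs $\gamma$ joining $x$ to $y$ in $G$. The linear dilatation of $f$ at $z\in G$ is $H(f,z)=\limsup_{|x-z|=|y-z|=r\to0^+}\frac{|f(x)-f(z)|}{|f(y)-f(z)|}$, and $H(f)\le C$ means $H(f,z)\le C$ for all $z\in G$. *)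

(* Defs.v *)
From HB Require Import structures.
From mathcomp Require Import all_boot all_order all_algebra.
From mathcomp Require Import all_classical all_reals all_analysis.

Set Implicit Arguments.
Unset Strict Implicit.
Unset Printing Implicit Defensive.

Import Order.TTheory GRing.Theory Num.Theory.
Import numFieldNormedType.Exports.

Local Open Scope classical_set_scope.
Local Open Scope ring_scope.

(* The library norm on 'rV[R]_n is the sup norm. It induces the usual topology,
   but every metric quantity below has to use the Euclidean norm instead. *)
Definition euclid {R : realType} {n : nat} (x : 'rV[R]_n) : R :=
  Num.sqrt (\sum_(i < n) x ord0 i ^+ 2).

Definition dist_to {R : realType} {n : nat} (x : 'rV[R]_n)
    (A : set 'rV[R]_n) : R :=
  inf [set euclid (x - a) | a in A].

Definition boundary {R : realType} {n : nat} (A : set 'rV[R]_n) :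
    set 'rV[R]_n :=
  closure A `\` interior A.

Definition domain {R : realType} {n : nat} (G : set 'rV[R]_n) : Prop :=
  [/\ open G, connected G & G !=set0].

Definition distance_ratio {R : realType} {n : nat} (G : set 'rV[R]_n)
    (x y : 'rV[R]_n) : R :=
  ln (1 + euclid (x - y) /
          Num.min (dist_to x (boundary G)) (dist_to y (boundary G))).

Definition arc_length {R : realType} {n : nat} (gamma : R -> 'rV[R]_n)
    (a b : R) : \bar R :=
  ereal_sup [set (\sum_(0 <= i < size s)
      euclid (gamma (nth b (a :: s) i.+1) - gamma (nth b (a :: s) i)))%:E
    | s in itv_partition a b].

(* The normal representation: the curve g on [0, arc_length gamma a b] with
   gamma t = g (arc_length gamma a t). The point chosen by xget does not
   matter, since gamma is constant where its arc length is. *)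
Definition arc_length_param {R : realType} {n : nat} (gamma : R -> 'rV[R]_n)
    (a b s : R) : 'rV[R]_n :=
  gamma (xget a [set t | a <= t <= b /\ arc_length gamma a t = s%:E]).

Definition line_integral {R : realType} {n : nat} (rho : 'rV[R]_n -> \bar R)
    (gamma : R -> 'rV[R]_n) (a b : R) : \bar R :=
  (\int[lebesgue_measure]_(s in
      [set s : R | (0 <= s%:E <= arc_length gamma a b)%E])
    rho (arc_length_param gamma a b s))%E.

Definition rectifiable_arc {R : realType} {n : nat} (G : set 'rV[R]_n)
    (x y : 'rV[R]_n) (gamma : R -> 'rV[R]_n) (a b : R) : Prop :=
  [/\ a <= b, {within `[a, b], continuous gamma}, gamma @` `[a, b] `<=` G,
      gamma a = x /\ gamma b = y & (arc_length gamma a b < +oo)%E].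

(* The inverse is the one of \bar R, for which 0^-1 = +oo. *)
Definition quasihyperbolic {R : realType} {n : nat} (G : set 'rV[R]_n)
    (x y : 'rV[R]_n) : \bar R :=
  ereal_inf [set I : \bar R | exists gamma a b,
    rectifiable_arc G x y gamma a b /\
    I = line_integral (fun z => ((dist_to z (boundary G))%:E^-1)%E) gamma a b].

Definition bilipschitz_wrt {R : realType} {n : nat}
    (m : set 'rV[R]_n -> 'rV[R]_n -> 'rV[R]_n -> \bar R) (L : R)
    (G : set 'rV[R]_n) (f : 'rV[R]_n -> 'rV[R]_n) : Prop :=
  forall x y, G x -> G y ->
    (m G x y * L^-1%:E <= m (f @` G) (f x) (f y))%E /\
    (m (f @` G) (f x) (f y) <= L%:E * m G x y)%E.

(* Only the values of f on G matter, here and below. *)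
Definition homeomorphism_on {R : realType} {n : nat} (G : set 'rV[R]_n)
    (f : 'rV[R]_n -> 'rV[R]_n) : Prop :=
  {within G, continuous f} /\
  exists2 g : 'rV[R]_n -> 'rV[R]_n,
    {within f @` G, continuous g} & forall x, G x -> g (f x) = x.

Definition continuously_differentiable {R : realType} {n : nat}
    (g : 'rV[R]_n -> 'rV[R]_n) : Prop :=
  (forall p, differentiable g p) /\
  continuous (fun p => jacobian g p : 'M[R]_n).

(* The Brouwer degree deg(f, D, y) equals d, for D bounded open and
   y \notin f(boundary D): f is replaced by a C^1 map g that is closer to f than
   the distance from y to f(boundary D) and has y as a regular value, and the
   signs of the Jacobian determinant are summed over the fibre s of g over y.
   The sum does not depend on the choice of g. *)
Definition brouwer_degree {R : realType} {n : nat}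
    (f : 'rV[R]_n -> 'rV[R]_n) (D : set 'rV[R]_n) (y : 'rV[R]_n)
    (d : int) : Prop :=
  exists (g : 'rV[R]_n -> 'rV[R]_n) (s : seq 'rV[R]_n),
    [/\ continuously_differentiable g,
        forall x, closure D x ->
          euclid (g x - f x) < dist_to y (f @` boundary D),
        uniq s /\ (forall x, x \in s <-> D x /\ g x = y),
        forall x, x \in s -> \det (jacobian g x) != 0 &
        d = \sum_(x <- s) sgz (\det (jacobian g x))].

Definition sense_preserving {R : realType} {n : nat} (G : set 'rV[R]_n)
    (f : 'rV[R]_n -> 'rV[R]_n) : Prop :=
  forall (D : set 'rV[R]_n) (y : 'rV[R]_n),
    domain D -> compact (closure D) -> closure D `<=` G ->
    (f @` D) y -> ~ (f @` boundary D) y ->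
    exists2 d : int, brouwer_degree f D y d & 0 < d.

(* limsup as r -> 0+ of the supremum of |f x - f z| / |f y - f z| over
   |x - z| = |y - z| = r. *)
Definition linear_dilatation {R : realType} {n : nat} (G : set 'rV[R]_n)
    (f : 'rV[R]_n -> 'rV[R]_n) (z : 'rV[R]_n) : \bar R :=
  limf_esup (fun r : R =>
    ereal_sup [set q : \bar R | exists x y : 'rV[R]_n,
      [/\ G x, G y, euclid (x - z) = r, euclid (y - z) = r &
          q = (euclid (f x - f z) / euclid (f y - f z))%:E]])
    (0 : R)^'+.

(* The metric definition of quasiconformality. *)
Definition quasiconformal {R : realType} {n : nat} (G : set 'rV[R]_n)
    (f : 'rV[R]_n -> 'rV[R]_n) : Prop :=
  homeomorphism_on G f /\
  exists C : R, forall z, G z -> (linear_dilatation G f z <= C%:E)%E.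

(* Main.v *)
(* Let m be either metric, z a point of a set D with d = d(z, bd D) > 0, and
   a = |z - w| small. Then a / (d + a) <= m_D(z, w) <= a / (d - a): for j this is
   1 - 1/t <= ln t <= t - 1; for k, integrate along a segment from above, and from
   below use d(u, bd D) <= d + s at arc length s from z. Hence m_D(z, w) ~ a / d,
   and applying this at z in G and at f z in f G, with the bilipschitz condition,
   gives |f x - f z| / |f y - f z| <= L^2 (1 + o(1)) when |x - z| = |y - z|.

   That d(f z, bd (f G)) > 0 follows from the bilipschitz condition: if it were 0,
   then k_{fG}(f z, f w) >= 1 for all w <> z (respectively j_{fG}(f z, f w) =
   ln (1 + |f z - f w| / 0) = 0), whereas m_G(z, w) is positive and tends to 0 as
   w tends to z. So f z is interior to f G. *)
Require Import Defs.
From mathcomp Require Import all_boot all_order all_algebra.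
From mathcomp Require Import all_classical all_reals all_analysis.
From mathcomp Require Import ring lra.
Set Implicit Arguments.
Unset Strict Implicit.
Unset Printing Implicit Defensive.

Import Order.TTheory GRing.Theory Num.Theory.
Import numFieldNormedType.Exports.
Local Open Scope classical_set_scope.
Local Open Scope ring_scope.

(** * Euclidean norm, neighbourhoods and distance to the boundary *)

Lemma cauchy_schwarz (R : realFieldType) (I : finType) (a b : I -> R) :
  (\sum_i a i * b i) ^+ 2 <= (\sum_i a i ^+ 2) * (\sum_i b i ^+ 2).
Proof.
(* Lagrange's identity: this double sum of squares is twice the gap in the inequality. *)
have key : 0 <= \sum_i \sum_j (a i * b j - a j * b i) ^+ 2.
  by apply: sumr_ge0 => i _; apply: sumr_ge0 => j _; exact: sqr_ge0.
have E : \sum_i \sum_j (a i * b j - a j * b i) ^+ 2 =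
  ((\sum_i a i ^+ 2) * (\sum_i b i ^+ 2) - (\sum_i a i * b i) ^+ 2) *+ 2.
  rewrite mulr2n {2}[(\sum_i a i ^+ 2) * _]mulrC [(\sum_i a i * b i) ^+ 2]expr2.
  rewrite !big_distrlr/= addrACA -opprD -!big_split -sumrN -big_split/=.
  apply: eq_bigr => i _; rewrite -!big_split -sumrN -big_split/=.
  by apply: eq_bigr => j _; ring.
by move: key; rewrite E pmulrn_lge0// subr_ge0.
Qed.

Section Euclid.
Context {R : realType} {n : nat}.
Implicit Types x y z u v w : 'rV[R]_n.

Lemma euclid_ge0 x : 0 <= euclid x.
Proof. exact: sqrtr_ge0. Qed.

Lemma euclid_sqr x : euclid x ^+ 2 = \sum_(i < n) x ord0 i ^+ 2.
Proof. by rewrite sqr_sqrtr// sumr_ge0// => i _; rewrite sqr_ge0. Qed.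

Lemma euclidZ (a : R) x : euclid (a *: x) = `|a| * euclid x.
Proof.
rewrite /euclid -sqrtr_sqr -sqrtrM ?sqr_ge0// mulr_sumr; congr Num.sqrt.
by apply: eq_bigr => i _; rewrite mxE exprMn.
Qed.

Lemma euclid0 : euclid (0 : 'rV[R]_n) = 0.
Proof. by rewrite -[0 in LHS](scale0r (0 : 'rV[R]_n)) euclidZ normr0 mul0r. Qed.

Lemma euclidBC x y : euclid (x - y) = euclid (y - x).
Proof. by rewrite -opprB -scaleN1r euclidZ normrN normr1 mul1r. Qed.

Lemma euclidD x y : euclid (x + y) <= euclid x + euclid y.
Proof.
rewrite -ler_sqr ?nnegrE ?addr_ge0 ?euclid_ge0// sqrrD !euclid_sqr.
have -> : \sum_(i < n) (x + y) ord0 i ^+ 2 = \sum_(i < n) x ord0 i ^+ 2 +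
    (\sum_(i < n) x ord0 i * y ord0 i) *+ 2 + \sum_(i < n) y ord0 i ^+ 2.
  by rewrite -sumrMnl -!big_split; apply: eq_bigr => i _; rewrite mxE sqrrD.
rewrite lerD2r lerD2l lerMn2r/=.
rewrite (le_trans (ler_norm _))// -ler_sqr ?nnegrE ?mulr_ge0 ?euclid_ge0//.
by rewrite exprMn !euclid_sqr real_normK ?num_real// cauchy_schwarz.
Qed.

Lemma euclid_triangle y x z : euclid (x - z) <= euclid (x - y) + euclid (y - z).
Proof. by rewrite -[x - z](subrKA y) euclidD. Qed.

Lemma coord_le_euclid x i : `|x ord0 i| <= euclid x.
Proof.
rewrite -ler_sqr ?nnegrE ?euclid_ge0// euclid_sqr real_normK ?num_real//.
rewrite (bigD1 i)//= lerDl sumr_ge0// => j _; exact: sqr_ge0.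
Qed.

Lemma euclid_eq0 x : euclid x = 0 -> x = 0.
Proof.
move=> x0; apply/rowP => i; apply/eqP; rewrite mxE -normr_le0 -x0.
exact: coord_le_euclid.
Qed.

(** The Euclidean norm dominates each coordinate; conversely a sup-norm ball of radius [e / n.+1]
    lies in the Euclidean ball of radius [e], since [n < n.+1 ^ 2]. The successor keeps the radius
    meaningful at [n = 0]. *)
Lemma nbhs_euclid z (A : set 'rV[R]_n) :
  nbhs z A <-> exists2 e : R, 0 < e & forall w, euclid (w - z) < e -> A w.
Proof.
split=> [/nbhs_ballP[e /= e0 eA]|[e e0 eA]].
  exists e => // w we; apply: eA; split => // i j; rewrite ord1 /ball/=.
  rewrite distrC (le_lt_trans _ we)// (le_trans _ (coord_le_euclid _ j))//.
  by rewrite !mxE.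
apply/nbhs_ballP; exists (e / n.+1%:R); first by rewrite /= divr_gt0.
move=> w [c0 zw]; apply: eA.
rewrite -(@ltr_pXn2r _ 2)// ?nnegrE ?euclid_ge0 ?ltW// euclid_sqr.
apply: (@le_lt_trans _ _ (\sum_(i < n) (e / n.+1%:R) ^+ 2)).
  apply: ler_sum => i _; rewrite -[leLHS]real_normK ?num_real//.
  rewrite ler_pXn2r ?nnegrE ?(ltW c0)//.
  by have /ltW := zw ord0 i; rewrite !mxE distrC.
rewrite sumr_const card_ord -[ltLHS]mulr_natr expr_div_n mulrAC.
rewrite ltr_pdivrMr ?exprn_gt0// ltr_pM2l ?exprn_gt0// -natrX ltr_nat.
exact: (@leq_pmull n.+1 n.+1).
Qed.

Lemma dist_to_ge0 z (A : set 'rV[R]_n) : 0 <= dist_to z A.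
Proof.
have [->|/set0P[a Aa]] := eqVneq A set0; first by rewrite /dist_to image_set0 inf0.
apply: lb_le_inf; first by exists (euclid (z - a)), a.
by move=> _ [b _ <-]; exact: euclid_ge0.
Qed.

Lemma dist_to_le (A : set 'rV[R]_n) x a : A a -> dist_to x A <= euclid (x - a).
Proof.
move=> Aa; apply: ge_inf; last by exists a.
by exists 0 => _ [b _ <-]; exact: euclid_ge0.
Qed.

Lemma dist_to_lipschitz (A : set 'rV[R]_n) x y :
  dist_to x A <= dist_to y A + euclid (x - y).
Proof.
have [->|/set0P[a0 Aa0]] := eqVneq A set0.
  by rewrite /dist_to !image_set0 inf0 add0r euclid_ge0.
rewrite -lerBlDr; apply: lb_le_inf; first by exists (euclid (y - a0)), a0.
move=> _ [a Aa <-]; rewrite lerBlDr [leRHS]addrC.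
exact: le_trans (dist_to_le x Aa) (euclid_triangle _ _ _).
Qed.

Lemma dist_boundary_gt0 (D : set 'rV[R]_n) z :
  nbhs z D -> boundary D !=set0 -> 0 < dist_to z (boundary D).
Proof.
move=> /nbhs_interior/nbhs_euclid[e e0 eD] [a0 Da0].
rewrite (lt_le_trans e0)//; apply: lb_le_inf.
  by exists (euclid (z - a0)), a0.
move=> _ [a [_ Da] <-]; rewrite leNgt; apply/negP => ae; apply: Da.
by apply: eD; rewrite euclidBC.
Qed.

(** A point of [D] outside its interior belongs to [boundary D] and so has distance 0 to it. This is
    how [f z] is seen to be interior to the image. *)
Lemma nbhs_of_dist_gt0 (D : set 'rV[R]_n) z :
  D z -> 0 < dist_to z (boundary D) -> nbhs z D.
Proof.
move=> Dz d0; apply: contrapT => Nz.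
have /(dist_to_le z) : boundary D z by split => //; exact: subset_closure.
by rewrite subrr euclid0 leNgt d0.
Qed.

(** With empty boundary [D] would be clopen, and so would its trace on each line through [z];
    connectedness of the real line then puts every point in [D]. A nonempty boundary matters because
    [dist_to z set0] is 0. *)
Lemma boundary_neq0 (D : set 'rV[R]_n) :
  open D -> D !=set0 -> D <> setT -> boundary D !=set0.
Proof.
move=> oD [z Dz] DT; apply/set0P/negP => /eqP B0; apply: DT.
have cD : closed D.
  rewrite closure_id; apply/seteqP; split; first exact: subset_closure.
  move=> w cw; apply: contrapT => Dw.
  suff : boundary D w by rewrite B0.
  by split => // /interior_subset.
apply/seteqP; split => // w _.
pose line (t : R) : 'rV[R]_n := z + t *: (w - z).
have cline : continuous line.
  by move=> t; apply: cvgD; [exact: cvg_cst|apply: cvgZr_tmp; exact: cvg_id].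
have : connected [set: R] by apply/connected_intervalP.
move=> /(_ (line @^-1` D)) H.
have /seteqP[_ /(_ 1 Logic.I)] : line @^-1` D = setT.
  apply: H.
  - by exists 0; rewrite /= /line scale0r addr0.
  - exists (line @^-1` D); last by rewrite setTI.
    by apply: open_comp => // ? _; exact: cline.
  - exists (line @^-1` D); last by rewrite setTI.
    by apply: closed_comp => // ? _; exact: cline.
by rewrite /= /line scale1r addrC subrK.
Qed.

End Euclid.

(** * Two-sided local estimates for both metrics *)

Lemma ge0_le_integral_patch d (T : measurableType d) (R : realType)
    (mu : {measure set T -> \bar R}) (D1 D2 : set T) (f1 f2 : T -> \bar R) :
  (forall x, D1 x -> 0 <= f1 x)%E -> (forall x, D2 x -> 0 <= f2 x)%E ->
  (forall x, (f1 \_ D1) x <= (f2 \_ D2) x)%E ->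
  (\int[mu]_(x in D1) f1 x <= \int[mu]_(x in D2) f2 x)%E.
Proof.
(* Both integrals are suprema over the simple functions below the integrand extended by 0, so a
   pointwise comparison suffices; integrands along a curve are not known to be measurable. *)
move=> f10 f20 f12; rewrite !ge0_integralE//.
apply: ereal_sup_le => _ [h hf <-]; exists h => // x.
exact: le_trans (f12 x).
Qed.

Lemma lebesgue_measure_itv0 (R : realType) (r : R) : 0 <= r ->
  lebesgue_measure (`[0, r]%classic : set R) = r%:E.
Proof.
move=> r0; rewrite lebesgue_measure_itv /= lte_fin -EFinB subr0.
have [//|r_le0] := ltP 0 r.
by congr _%:E; apply/eqP; rewrite eq_le r0 r_le0.
Qed.

Section LocalBounds.
Context {R : realType} {n : nat}.
Implicit Types (x y z w : 'rV[R]_n) (D : set 'rV[R]_n).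

Lemma euclid_le_arc_length (gamma : R -> 'rV[R]_n) (a b : R) : a <= b ->
  ((euclid (gamma b - gamma a))%:E <= arc_length gamma a b)%E.
Proof.
(* Partitions increase strictly and omit their starting point, so the coarsest one is [[::]] if
   [a = b] and [[:: b]] otherwise. *)
rewrite le_eqVlt => /predU1P[<-|ab]; apply: ereal_sup_ubound.
  exists [::]; first by split => //; rewrite eqxx.
  by rewrite big_geq// subrr euclid0.
exists [:: b]; first exact: itv_partition1.
by rewrite /= big_nat1.
Qed.

Lemma arc_length_segment_le x v :
  (arc_length (fun t : R => (x + t *: v)%R) 0 1 <= (euclid v)%:E)%E.
Proof.
apply: ge_ereal_sup => _ [s s01 <-]; rewrite lee_fin.
(* Each partition sum is [euclid v] times the variation of the identity on [0, 1], which is 1. *)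
have : variation 0 1 (@idfun R) s = 1 - 0 by apply: nondecreasing_variation s01.
rewrite subr0 => var1; rewrite -[leRHS]mul1r -[X in _ <= X * _]var1 mulr_suml.
by apply: ler_sum => i _; rewrite opprD addrACA subrr add0r -scalerBl euclidZ.
Qed.

(* When no parameter has arc length [s], the junk value of [xget] is the initial
   parameter [a], so continuity of the arc length is not needed. *)
Lemma arc_length_param_dist (gamma : R -> 'rV[R]_n) (a b s : R) : 0 <= s ->
  euclid (arc_length_param gamma a b s - gamma a) <= s.
Proof.
move=> s0; rewrite /arc_length_param.
case: xgetP => [t _ [/andP[at_ tb] ts]|_]; last by rewrite subrr euclid0.
by rewrite -lee_fin -ts euclid_le_arc_length.
Qed.

Lemma arc_length_param_range (gamma : R -> 'rV[R]_n) (a b s : R) : a <= b ->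
  exists2 t, a <= t <= b & arc_length_param gamma a b s = gamma t.
Proof.
move=> ab; rewrite /arc_length_param.
case: xgetP => [t _ [? _]|_]; first by exists t.
by exists a; rewrite ?lexx.
Qed.

(** Every arc from [z] to [w] has length at least [r], and at arc length [s <= r] it is within [r]
    of [z], where the density is at least [1 / (dz + r)]; integrate this constant over [0, r]. For
    [dz = 0] the bound is 1, the case that later rules out an image point at distance 0. *)
Lemma quasihyperbolic_ge D z w : z != w ->
  ((euclid (z - w) / (dist_to z (boundary D) + euclid (z - w)))%:E
    <= quasihyperbolic D z w)%E.
Proof.
move=> zw; set r := euclid (z - w); set dz := dist_to z _.
have r0 : 0 < r.
  rewrite lt_neqAle euclid_ge0 andbT eq_sym; apply: contraNneq zw => /euclid_eq0.
  by move/eqP; rewrite subr_eq0.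
have dz0 : 0 <= dz by exact: dist_to_ge0.
apply: le_ereal_inf_tmp => _ [gamma [a [b [[ab _ _ [ga gb] _] ->]]]].
rewrite mulrC EFinM -(lebesgue_measure_itv0 (ltW r0)) -integral_cst//.
apply: ge0_le_integral_patch => s.
- by rewrite /cst lee_fin invr_ge0 addr_ge0// ltW.
- by rewrite inve_ge0 lee_fin dist_to_ge0.
rewrite /patch; case: ifPn => [|_]; last first.
  by case: ifPn => // _; rewrite inve_ge0 lee_fin dist_to_ge0.
rewrite inE /= in_itv/= => /andP[s0 sr].
rewrite mem_set/=; last first.
  rewrite lee_fin s0/=; apply: le_trans (euclid_le_arc_length gamma ab).
  by rewrite lee_fin ga gb euclidBC.
have dE : ((dz + r)^-1)%:E = ((dz + r)%:E^-1)%E.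
  by rewrite inver gt_eqF// ltr_wpDl.
rewrite /cst dE lee_pV2 ?inE/= ?lee_fin ?dist_to_ge0 ?addr_ge0 ?(ltW r0)//.
rewrite (le_trans (dist_to_lipschitz _ _ z))// lerD2l.
by rewrite (le_trans _ sr)// -ga arc_length_param_dist.
Qed.

(** The segment has length at most [a] and stays within [a] of [z], where the density is at most
    [1 / (dz - a)]. The radius [r] keeps the segment inside [D]. *)
Lemma quasihyperbolic_segment_le D z w (r : R) :
  (forall u, euclid (u - z) < r -> D u) -> euclid (z - w) < r ->
  euclid (z - w) < dist_to z (boundary D) ->
  (quasihyperbolic D z w <=
    (euclid (z - w) / (dist_to z (boundary D) - euclid (z - w)))%:E)%E.
Proof.
set a := euclid (z - w); set dz := dist_to z _ => zrD ar adz.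
pose gamma (t : R) : 'rV[R]_n := z + t *: (w - z).
have lgamma : (arc_length gamma 0 1 <= a%:E)%E.
  by rewrite /a euclidBC; exact: arc_length_segment_le.
have gamma_z t : 0 <= t <= 1 -> euclid (gamma t - z) <= a.
  move=> /andP[t0 t1]; rewrite addrAC subrr add0r euclidZ euclidBC ger0_norm//.
  by rewrite ler_piMl// euclid_ge0.
apply: ge_ereal_inf; exists (line_integral
    (fun u => ((dist_to u (boundary D))%:E^-1)%E) gamma 0 1).
  exists gamma, 0, 1; split => //; split => //.
  - apply: continuous_subspaceT => t.
    by apply: cvgD; [exact: cvg_cst|apply: cvgZr_tmp; exact: cvg_id].
  - move=> _ [t /= /[!in_itv]/= t01 <-]; apply: zrD.
    exact: le_lt_trans (gamma_z _ t01) ar.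
  - by rewrite /gamma scale0r addr0 scale1r addrC subrK.
  - by rewrite (le_lt_trans lgamma) ?ltry.
have a0 : 0 <= a by exact: euclid_ge0.
rewrite [X in (_ <= X)%E](_ : _ =
    \int[lebesgue_measure]_(s in `[0%R, a]) cst ((dz - a)^-1)%:E s)%E; last first.
  rewrite integral_cst// mulrC EFinM; congr (_ * _)%E.
  exact/esym/lebesgue_measure_itv0.
have da0 : 0 < dz - a by rewrite subr_gt0.
apply: ge0_le_integral_patch => s.
- by rewrite inve_ge0 lee_fin dist_to_ge0.
- by rewrite /cst lee_fin invr_ge0 ltW.
rewrite /patch; case: ifPn => [|_]; last first.
  by case: ifPn => // _; rewrite /cst lee_fin invr_ge0 ltW.
rewrite inE /= => /andP[s0 sl].
rewrite mem_set/=; last first.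
  by rewrite in_itv/= -!lee_fin s0 (le_trans sl).
have dE : ((dz - a)^-1)%:E = ((dz - a)%:E^-1)%E by rewrite inver gt_eqF.
rewrite /cst dE lee_pV2 ?inE/= ?lee_fin ?dist_to_ge0 ?(ltW da0)//.
have [t t01 ->] := arc_length_param_range gamma s (@ler01 R).
rewrite lerBlDr (le_trans (dist_to_lipschitz _ _ (gamma t)))// lerD2l.
by rewrite euclidBC gamma_z.
Qed.

(** The minimum of the two distances is at least [dz - a], and [ln (1 + x) <= x]. *)
Lemma distance_ratio_le D z w : euclid (z - w) < dist_to z (boundary D) ->
  distance_ratio D z w <=
    euclid (z - w) / (dist_to z (boundary D) - euclid (z - w)).
Proof.
set a := euclid (z - w); set dz := dist_to z _; set dw := dist_to w (boundary D).
move=> adz; have a0 : 0 <= a by exact: euclid_ge0.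
have mge : dz - a <= Num.min dz dw.
  rewrite le_min gerBl a0/= lerBlDr; exact: dist_to_lipschitz.
have m0 : 0 < Num.min dz dw by rewrite (lt_le_trans _ mge)// subr_gt0.
rewrite /distance_ratio -/a -/dz -/dw (le_trans (le_ln1Dx _))//.
  by rewrite (@lt_le_trans _ _ 0)// ?ltrN10// divr_ge0// ltW.
by rewrite ler_wpM2l// lef_pV2// ?posrE// subr_gt0.
Qed.

Lemma distance_ratio_ge D z w : euclid (z - w) < dist_to z (boundary D) ->
  euclid (z - w) / (dist_to z (boundary D) + euclid (z - w)) <=
    distance_ratio D z w.
Proof.
set a := euclid (z - w); set dz := dist_to z _; set dw := dist_to w (boundary D).
move=> adz; have a0 : 0 <= a by exact: euclid_ge0.
have dz0 : 0 < dz by exact: le_lt_trans adz.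
have mge : dz - a <= Num.min dz dw.
  rewrite le_min gerBl a0/= lerBlDr; exact: dist_to_lipschitz.
have m0 : 0 < Num.min dz dw by rewrite (lt_le_trans _ mge)// subr_gt0.
rewrite /distance_ratio -/a -/dz -/dw.
have le1 : a / dz <= a / Num.min dz dw.
  by rewrite ler_wpM2l// lef_pV2// ?posrE// ge_min lexx.
have az0 : 0 <= a / dz by rewrite divr_ge0// ltW.
apply: (@le_trans _ _ (ln (1 + a / dz))); last first.
  by rewrite ler_ln ?posrE ?lerD2l// ltr_wpDr// (le_trans az0).
(* [ln t = - ln (1 / t) >= 1 - 1 / t] *)
have -> : 1 + a / dz = (1 - a / (dz + a))^-1.
  have -> : 1 - a / (dz + a) = dz / (dz + a).
    by rewrite -[X in X - _](divff (x := dz + a)) ?gt_eqF ?ltr_wpDr// -mulrBl addrK.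
  by rewrite invf_div mulrDl divff// gt_eqF.
rewrite lnV; last first.
  by rewrite posrE subr_gt0 ltr_pdivrMr ?ltr_wpDr// mul1r ltrDr.
rewrite lerNr; apply: le_ln1Dx; rewrite ltrN2.
by rewrite ltr_pdivrMr ?ltr_wpDr// mul1r ltrDr.
Qed.

(** The estimate shared by both metrics, isolated so that the dilatation bound is proved once. *)
Definition locally_comparable (m : 'rV[R]_n -> 'rV[R]_n -> \bar R) D z d :=
  exists2 rho : R, 0 < rho & forall w, D w -> z != w -> euclid (z - w) < rho ->
    ((euclid (z - w) / (d + euclid (z - w)))%:E <= m z w)%E /\
    (m z w <= (euclid (z - w) / (d - euclid (z - w)))%:E)%E.

Lemma distance_ratio_comparable D z : 0 < dist_to z (boundary D) ->
  locally_comparable (fun x y => (distance_ratio D x y)%:E) D z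
    (dist_to z (boundary D)).
Proof.
move=> dz0; exists (dist_to z (boundary D)) => // w _ _ zw.
by rewrite !lee_fin distance_ratio_ge// distance_ratio_le.
Qed.

Lemma quasihyperbolic_comparable D z : nbhs z D -> 0 < dist_to z (boundary D) ->
  locally_comparable (quasihyperbolic D) D z (dist_to z (boundary D)).
Proof.
move=> /nbhs_euclid[e e0 eD] dz0; exists (Num.min e (dist_to z (boundary D))).
  by rewrite lt_min e0.
move=> w _ zw; rewrite lt_min => /andP[we wd]; split.
  exact: quasihyperbolic_ge.
exact: quasihyperbolic_segment_le eD we wd.
Qed.

Lemma exists_euclid_sphere z (r : R) : (0 < n)%N -> 0 <= r ->
  exists w, euclid (z - w) = r.
Proof.
move=> n0 r0; pose v : 'rV[R]_n := const_mx 1.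
have v0 : euclid v != 0.
  apply/eqP => /euclid_eq0/rowP/(_ (Ordinal n0)); rewrite !mxE.
  by move/eqP; rewrite oner_eq0.
exists (z + (r / euclid v) *: v).
rewrite opprD addrA subrr add0r -scaleNr euclidZ normrN ger0_norm ?divfK//.
by rewrite divr_ge0// euclid_ge0.
Qed.

End LocalBounds.

(** * From the local estimates to the dilatation bound *)

Lemma ratio_le (R : realFieldType) (d d' L q r A B : R) :
  let t := (q - 1) / (q + 1) in
  0 < d -> 0 < d' -> 0 < L -> 1 < q ->
  0 < r -> r < t * d -> 0 <= A -> A < t * d' -> 0 <= B -> B < t * d' ->
  A / (d' + A) <= L * (r / (d - r)) -> r / (d + r) / L <= B / (d' - B) ->
  A / B <= L ^+ 2 * q ^+ 2.
Proof.
move=> t d0 d'0 L0 q1 r0 rt A0 At B0 Bt h1 h2.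
have q0 : 0 < q + 1 by lra.
(* The threshold [t] solves [(1 + t) / (1 - t) = q], so each of the two comparisons below costs
   exactly one factor [q]. *)
have tq : 1 + t = q * (1 - t) by rewrite /t; field; rewrite gt_eqF.
have t1 : 0 < 1 - t.
  have -> : 1 - t = 2 / (q + 1) by rewrite /t; field; rewrite gt_eqF.
  by rewrite divr_gt0.
have rd : r < d by nra.
have Ad : A < d' by nra.
have Bd : B < d' by nra.
have k1 : A * (d - r) <= L * r * (d' + A).
  move: h1; rewrite ler_pdivrMr; last lra.
  by rewrite mulrA mulrAC ler_pdivlMr// subr_gt0.
have k2 : r * (d' - B) <= L * B * (d + r).
  move: h2; rewrite !ler_pdivrMr ?addr_gt0//.
  rewrite [X in _ <= X -> _](_ : _ = L * B * (d + r) / (d' - B)); last by ring.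
  by rewrite ler_pdivlMr// subr_gt0.
(* In quotient form: [A / d' <= L q r / d] here and [r / d <= L q B / d'] in [l2]; chaining them
   gives the claim, and [l2] also forces [B > 0]. *)
have l1 : A * d <= L * q * r * d'.
  rewrite -(ler_pM2r t1).
  have e1 : A * (t * d) >= A * r by apply: ler_wpM2l => //; exact: ltW.
  have e2 : L * r * A <= L * r * (t * d').
    by apply: ler_wpM2l; [rewrite mulr_ge0// ltW|exact: ltW].
  have e3 : L * q * r * d' * (1 - t) = L * r * d' * (1 + t) by rewrite tq; ring.
  rewrite e3; nra.
have l2 : r * d' <= L * q * B * d.
  rewrite -(ler_pM2r t1).
  have e1 : r * B <= r * (t * d') by apply: ler_wpM2l => //; exact: ltW.
  have e2 : L * B * r <= L * B * (t * d).
    by apply: ler_wpM2l; [rewrite mulr_ge0// ltW|exact: ltW].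
  have e3 : L * q * B * d * (1 - t) = L * B * d * (1 + t) by rewrite tq; ring.
  rewrite e3; nra.
have Bp : 0 < B.
  rewrite lt_neqAle B0 andbT; apply: contraTneq l2 => <-.
  by rewrite mulr0 mul0r -ltNge mulr_gt0.
rewrite ler_pdivrMr// -(ler_pM2r d0).
have e1 : L * q * (r * d') <= L * q * (L * q * B * d).
  by apply: ler_wpM2l l2; rewrite mulr_ge0// ltW//; lra.
nra.
Qed.

Lemma linear_dilatation_le (R : realType) (n : nat)
    (m : set 'rV[R]_n -> 'rV[R]_n -> 'rV[R]_n -> \bar R) (L : R)
    (G : set 'rV[R]_n) (f : 'rV[R]_n -> 'rV[R]_n) (z : 'rV[R]_n) (d d' : R) :
  0 < L -> bilipschitz_wrt m L G f -> G z -> {for z, continuous f} ->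
  (forall w, G w -> f z = f w -> z = w) -> 0 < d -> 0 < d' ->
  locally_comparable (m G) G z d ->
  locally_comparable (m (f @` G)) (f @` G) (f z) d' ->
  (linear_dilatation G f z <= (L ^+ 2)%:E)%E.
Proof.
move=> L0 bil Gz cf fi d0 d'0 [rho rho0 mG] [rho' rho'0 mfG].
apply/lee_addgt0Pr => e e0.
(* Chosen so that [L ^+ 2 * q ^+ 2 = L ^+ 2 + e]. *)
pose q := Num.sqrt (1 + e / L ^+ 2).
have eL0 : 0 < e / L ^+ 2 by rewrite divr_gt0// exprn_gt0.
have q1 : 1 < q by rewrite /q -[ltLHS]sqrtr1 ltr_sqrt ?ltrDl// addr_gt0.
have -> : ((L ^+ 2)%:E + e%:E = (L ^+ 2 * q ^+ 2)%:E)%E.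
  rewrite -EFinD sqr_sqrtr ?addr_ge0 ?ltW// mulrDr mulr1 mulrC divfK//.
  by rewrite expf_neq0// gt_eqF.
pose t := (q - 1) / (q + 1).
have t0 : 0 < t by rewrite divr_gt0//; lra.
have /nbhs_euclid[e1 e10 fe1] : nbhs z (f @^-1`
    [set u | euclid (u - f z) < Num.min rho' (t * d')]).
  apply: cf; apply/nbhs_euclid; exists (Num.min rho' (t * d')) => //.
  by rewrite lt_min rho'0 mulr_gt0.
(* Below [tau] three things hold: [f] maps the sphere close enough to [f z], the estimate for [m G]
   applies, and [r < t * d]. *)
pose tau := Num.min e1 (Num.min rho (t * d)).
have tau0 : 0 < tau by rewrite !lt_min e10 rho0 mulr_gt0.
(* The upper limit is an infimum over the sets of the filter, so the single set of [r] in (0, tau)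
   bounds it. *)
apply: ge_ereal_inf; eexists.
  exists [set r | 0 < r < tau]; last reflexivity.
  near=> r => /=; apply/andP; split; near: r.
    exact: nbhs_right_gt.
  exact: nbhs_right_lt.
apply: ge_ereal_sup => _ [r /= /andP[r0 rtau] <-].
apply: ge_ereal_sup => _ [x [y [Gx Gy xr yr ->]]]; rewrite lee_fin.
move: rtau; rewrite !lt_min => /and3P[re1 rrho rt].
have near_f w : euclid (w - z) = r ->
    euclid (f z - f w) < rho' /\ euclid (f z - f w) < t * d'.
  move=> wr; have /= := fe1 w; rewrite wr lt_min euclidBC => /(_ re1).
  by move/andP.
have neq w : euclid (w - z) = r -> z != w.
  by move=> wr; apply: contraTneq r0 => zw; rewrite -wr zw subrr euclid0 ltxx.
have neqf w : G w -> euclid (w - z) = r -> f z != f w.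
  by move=> Gw wr; apply: contra_neq (neq _ wr); exact: fi.
have [fx1 fx2] := near_f _ xr; have [fy1 fy2] := near_f _ yr.
rewrite (euclidBC (f x)) (euclidBC (f y)).
apply: (@ratio_le R d d' L q r) => //; try exact: euclid_ge0.
(* The upper bilipschitz inequality bounds the numerator; the lower one, in the next bullet, handles
   the denominator. *)
- have [_ ub] := mG _ Gx (neq _ xr) (eq_ind_r (fun s => s < rho) rrho
     (etrans (euclidBC z x) xr)).
  have [lb _] := mfG (f x) (ex_intro2 _ _ x Gx erefl) (neqf _ Gx xr) fx1.
  have [_ bl] := bil _ _ Gz Gx.
  rewrite -lee_fin (le_trans lb)// (le_trans bl)// [leRHS]EFinM.
  by rewrite lee_pmul2l ?lte_fin// -xr [in X in (_ <= X)%E]euclidBC.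
- have [lb _] := mG _ Gy (neq _ yr) (eq_ind_r (fun s => s < rho) rrho
     (etrans (euclidBC z y) yr)).
  have [_ ub] := mfG (f y) (ex_intro2 _ _ y Gy erefl) (neqf _ Gy yr) fy1.
  have [bl _] := bil _ _ Gz Gy.
  rewrite -lee_fin (le_trans _ ub)// (le_trans _ bl)// [leLHS]EFinM.
  by rewrite lee_pmul2r ?lte_fin ?invr_gt0// -yr [in X in (X <= _)%E]euclidBC.
Unshelve. all: by end_near.
Qed.

(** * Positive distance of image points to the boundary of the image *)

Lemma quasihyperbolic_image_dist_gt0 (R : realType) (n : nat)
    (G : set 'rV[R]_n) (f : 'rV[R]_n -> 'rV[R]_n) (L : R) (z : 'rV[R]_n) :
  (0 < n)%N -> 0 < L -> bilipschitz_wrt quasihyperbolic L G f ->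
  nbhs z G -> 0 < dist_to z (boundary G) ->
  (forall w, G w -> f z = f w -> z = w) ->
  0 < dist_to (f z) (boundary (f @` G)).
Proof.
move=> n0 L0 bil zG dz0 fi; rewrite lt_neqAle dist_to_ge0 andbT eq_sym.
apply/eqP => d'0; have Gz := nbhs_singleton zG.
have [rho rho0 mG] := quasihyperbolic_comparable zG dz0.
have /nbhs_euclid[e e0 eG] := zG.
set dz := dist_to z _ in dz0 mG.
(* [r < dz / (L + 1)] makes [L * (r / (dz - r)) < 1], contradicting the lower bound 1 in the
   image. *)
pose r := Num.min (Num.min rho e) (dz / (L + 1)) / 2.
have r0 : 0 < r by rewrite divr_gt0// !lt_min rho0 e0 divr_gt0// addr_gt0.
have : r < Num.min (Num.min rho e) (dz / (L + 1)).
  by rewrite ltr_pdivrMr// ltr_pMr ?ltr1n// !lt_min rho0 e0 divr_gt0// addr_gt0.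
rewrite !lt_min -andbA => /and3P[rrho re rd].
have [w zw] := exists_euclid_sphere z n0 (ltW r0).
have Gw : G w by apply: eG; rewrite euclidBC zw.
have neq : z != w.
  by apply: contraTneq r0 => eq_zw; rewrite -zw eq_zw subrr euclid0 ltxx.
have neqf : f z != f w by apply: contra_neq neq; exact: fi.
have /(_ _)[|_ ub] := mG _ Gw neq _; first by rewrite zw.
have [_ bl] := bil _ _ Gz Gw.
have := le_trans (quasihyperbolic_ge (f @` G) neqf) bl.
rewrite d'0 add0r divff; last first.
  by apply: contra_neq neqf => /euclid_eq0/eqP; rewrite subr_eq0 => /eqP.
apply/negP; rewrite -ltNge.
apply: (@le_lt_trans _ _ (L%:E * (r / (dz - r))%:E)%E).
  by rewrite lee_pmul2l ?lte_fin// -zw.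
move: rd; rewrite ltr_pdivlMr ?addr_gt0// => rd.
have rdz : 0 < dz - r by nra.
by rewrite -EFinM lte_fin mulrA ltr_pdivrMr// mul1r; lra.
Qed.

Lemma distance_ratio_image_dist_gt0 (R : realType) (n : nat)
    (G : set 'rV[R]_n) (f : 'rV[R]_n -> 'rV[R]_n) (L : R) (z : 'rV[R]_n) :
  (0 < n)%N -> 0 < L ->
  bilipschitz_wrt (fun D x y => (distance_ratio D x y)%:E) L G f ->
  nbhs z G -> 0 < dist_to z (boundary G) ->
  0 < dist_to (f z) (boundary (f @` G)).
Proof.
move=> n0 L0 bil zG dz0; rewrite lt_neqAle dist_to_ge0 andbT eq_sym.
apply/eqP => d'0; have Gz := nbhs_singleton zG.
have /nbhs_euclid[e e0 eG] := zG.
set dz := dist_to z _ in dz0.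
pose r := Num.min e dz / 2.
have r0 : 0 < r by rewrite divr_gt0// !lt_min e0.
have : r < Num.min e dz by rewrite ltr_pdivrMr// ltr_pMr ?ltr1n// lt_min e0.
rewrite lt_min => /andP[re rd].
have [w zw] := exists_euclid_sphere z n0 (ltW r0).
have Gw : G w by apply: eG; rewrite euclidBC zw.
have [bl _] := bil _ _ Gz Gw; move: bl.
(* The minimum is 0 and [0^-1 = 0], so the image distance is [ln 1 = 0], while its lower bilipschitz
   bound is positive. *)
rewrite {2}/distance_ratio d'0 (min_idPl (dist_to_ge0 _ _)) invr0 mulr0 addr0 ln1.
rewrite -EFinM lee_fin leNgt => /negP; apply.
rewrite mulr_gt0 ?invr_gt0//.
rewrite (lt_le_trans _ (distance_ratio_ge _))// zw//.
by rewrite divr_gt0// addr_gt0.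
Qed.

(** * The bound at each point, for either metric *)

Theorem corollary4p6 (R : realType) (n : nat) (hn : (2 <= n)%N)
    (G : set 'rV[R]_n) (f : 'rV[R]_n -> 'rV[R]_n) (L : R)
    (hG : domain G) (hGT : G <> setT) (hfGT : f @` G <> setT)
    (hf : homeomorphism_on G f) (hsp : sense_preserving G f) (hL : 1 <= L)
    (hbil : bilipschitz_wrt (fun D x y => (distance_ratio D x y)%:E) L G f \/
            bilipschitz_wrt quasihyperbolic L G f) :
  quasiconformal G f /\
  (forall z, G z -> (linear_dilatation G f z <= (L ^+ 2)%:E)%E).
Proof.
have bound z : G z -> (linear_dilatation G f z <= (L ^+ 2)%:E)%E.
  move=> Gz; have [oG _ G0] := hG; have [cf [g _ gK]] := hf.
  have n0 : (0 < n)%N by exact: leq_trans hn.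
  have L0 : 0 < L by exact: lt_le_trans hL.
  have zG : nbhs z G by exact: open_nbhs_nbhs.
  have dz0 := dist_boundary_gt0 zG (boundary_neq0 oG G0 hGT).
  have fz : {for z, continuous f}.
    by move: cf; rewrite continuous_open_subspace// => /(_ z); apply; rewrite inE.
  have fi w : G w -> f z = f w -> z = w by move=> Gw /(congr1 g); rewrite !gK.
  case: hbil => bil.
    have d'0 := distance_ratio_image_dist_gt0 n0 L0 bil zG dz0.
    by apply: (linear_dilatation_le L0 bil Gz fz fi dz0 d'0);
      exact: distance_ratio_comparable.
  have d'0 := quasihyperbolic_image_dist_gt0 n0 L0 bil zG dz0 fi.
  apply: (linear_dilatation_le L0 bil Gz fz fi dz0 d'0);
    apply: quasihyperbolic_comparable => //.
  (* The segment estimate at [f z] needs a neighbourhood of [f z] inside the image, which [d'0]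
     supplies. *)
  by apply: nbhs_of_dist_gt0 => //; exists z.
by split => //; split => //; exists (L ^+ 2).
Qed.
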